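(* Let $k\geq 4$ be an integer. Then every integer $n>\max\{20k,1200\}$ can be written as $n=x_1+\cdots+x_k$ with $x_1,\ldots,x_k$ positive integers such that $x_1^2+\cdots+x_k^2$ is a perfect square.
   Context: A perfect square means the square of an integer. *)

(* Defs.v *)
From mathcomp Require Import all_boot all_order all_algebra.
Set Implicit Arguments.
Unset Strict Implicit.
Unset Printing Implicit Defensive.

Definition perfect_square (a : nat) : Prop :=
  exists z : int, (a%:Z = z ^+ 2)%R.

(* Main.v *)
Require Import Defs.
From mathcomp Require Import all_boot all_order all_algebra.
From mathcomp Require Import zify ring.

Import GRing.Theory Num.Theory.

(** Everything rests on one identity.  If [s] is a list of positive integers
    whose sum of squares is [h ^ 2 + 2 * c], then the entries [h * x] for [x]
    in [s], together with [c], have sum of squares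
    [h ^ 2 * (h ^ 2 + 2 * c) + c ^ 2 = (h ^ 2 + c) ^ 2].  Hence every
    [n = h * sumn s + c] of this form is representable by [size s + 1] summands
    ([representable_cone]); this is the rational parametrization of the cone
    [x_1 ^ 2 + ... + x_k ^ 2 = m ^ 2].  Eliminating [c] and writing
    [t = x + h], the condition becomes
    [2 * n + k * h ^ 2 = sum of the t ^ 2] over [k - 1] integers [t > h].

    For [k = 4] take [t_3 = 2 * h + u], and for [k = 5] take [t_3 = 2 * h] and
    [t_4 = h + 2].  The terms in [h ^ 2] then cancel, and the equation is linear
    in [h]:
    [2 * n = t_1 ^ 2 + t_2 ^ 2 + u ^ 2 + 4 * u * h], respectively
    [2 * n = t_1 ^ 2 + t_2 ^ 2 + 4 + 4 * h].  So it is enough to find [t_1] and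
    [t_2] in the right residue class with [t_1 ^ 2 + t_2 ^ 2] slightly below
    [2 * n], close enough that the resulting [h] is smaller than both.  Two
    almost equal numbers [q - i] and [q + i] (or [q + i + 1]) near [sqrt n] do
    this: the gap between consecutive [2 * q ^ 2] is comparable to the allowed
    range of [h], and a small shift [i] adjusts the residue and closes what
    remains of the gap ([window_pronic], [window_square2], [window_square4]).

    For [k >= 6] take [h = 1]: now [2 * n + k] must be a sum of [k - 1] squares
    of integers that are at least 2.  All but five of them are taken equal
    to 2; the other five come from Lagrange's four-square theorem, applied after
    169 has been set aside to replace the zeros and ones that it may
    return ([five_squares_ge2]). *)

(** * Lagrange's four-square theorem *)

Definition four_squares (z : int) : Prop :=
  exists a b c d : int, z = (a ^+ 2 + b ^+ 2 + c ^+ 2 + d ^+ 2)%R.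

(** Euler's identity: multiplicativity of the quaternion norm. *)
Lemma four_squaresM (x y : int) :
  four_squares x -> four_squares y -> four_squares (x * y)%R.
Proof.
move=> [a1 [a2 [a3 [a4 ->]]]] [b1 [b2 [b3 [b4 ->]]]].
exists (a1 * b1 + a2 * b2 + a3 * b3 + a4 * b4)%R,
  (a1 * b2 - a2 * b1 + a3 * b4 - a4 * b3)%R,
  (a1 * b3 - a3 * b1 + a4 * b2 - a2 * b4)%R,
  (a1 * b4 - a4 * b1 + a2 * b3 - a3 * b2)%R.
ring.
Qed.

(** Pigeonhole: the [(p + 1) / 2] residues [x ^ 2] and the [(p + 1) / 2] residues
    [- (y ^ 2 + 1)] cannot be disjoint modulo [p]. *)
Lemma prime_dvd_two_squares_succ p : prime p -> odd p ->
  exists a b, [/\ a.*2 < p, b.*2 < p & p %| a ^ 2 + b ^ 2 + 1].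
Proof.
move=> p_pr p_odd; have p_gt0 := prime_gt0 p_pr.
pose T := 'I_p./2.+1.
have halfp := odd_double_half p; rewrite p_odd in halfp.
have sq_inj (x y : T) : x <= y -> p %| y ^ 2 - x ^ 2 -> x = y.
  move=> le_xy; rewrite subn_sqr Euclid_dvdM //.
  have hx := ltn_ord x; have hy := ltn_ord y.
  case/orP=> pd; apply/val_inj => /=; apply/eqP.
    have [|] := posnP (y - x); first by lia.
    by move=> d0; have := dvdn_leq d0 pd; lia.
  have [|] := posnP (y + x); first by lia.
  by move=> d0; have := dvdn_leq d0 pd; lia.
have sq_inj' (x y : T) : x ^ 2 = y ^ 2 %[mod p] -> x = y.
  have [le|/ltnW le] := leqP x y => /eqP.
    by rewrite eq_sym eqn_mod_dvd ?leq_sqr // => /(sq_inj _ _ le).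
  by rewrite eqn_mod_dvd ?leq_sqr // => /(sq_inj _ _ le).
(* Adding p ^ 2 keeps the representative of -(y ^ 2 + 1) natural. *)
pose f (z : T + T) : 'I_p := match z with
  | inl x => Ordinal (ltn_pmod (x ^ 2) p_gt0)
  | inr y => Ordinal (ltn_pmod (p ^ 2 - (y ^ 2 + 1)) p_gt0) end.
have small (y : T) : y ^ 2 + 1 <= p ^ 2.
  by have := ltn_ord y; rewrite -!mulnn; nia.
have : ~~ injectiveb f.
  apply/negP => /injectiveP /leq_card.
  by rewrite card_sum !card_ord; lia.
case/injectivePn => z [z' nzz' ].
have main (x y : T) : f (inl x) = f (inr y) ->
    exists a b, [/\ a.*2 < p, b.*2 < p & p %| a ^ 2 + b ^ 2 + 1].
  move=> /(congr1 val) /= e; exists x, y.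
  have hx := ltn_ord x; have hy := ltn_ord y; split; [lia|lia|].
  rewrite -addnA /dvdn -modnDml e modnDml subnK //.
  by rewrite -mulnn modnMl.
(* A collision within one summand contradicts injectivity of squaring on T. *)
case: z z' nzz' => [x|x] [y|y] nxy.
- by move/(congr1 val) => /= /sq_inj' exy; rewrite exy eqxx in nxy.
- exact: main.
- by move/esym; apply: main.
- move/(congr1 val) => /= e; case/negP: nxy; apply/eqP; congr inr.
  apply: sq_inj'; apply/eqP; rewrite -(eqn_modDr 1).
  rewrite -(eqn_modDl (p ^ 2 - (x ^ 2 + 1))).
  rewrite subnK // addnC.
  by apply/eqP; rewrite -modnDmr e modnDmr addnC subnK.
Qed.

Lemma centered_residue (m : nat) (x : int) : 0 < m ->
  exists z : int, (- m%:Z < 2 * (x - m%:Z * z) <= m%:Z)%R.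
Proof.
move=> m0; exists ((2 * x + m%:Z - 1) %/ (2 * m%:Z))%Z.
have := divz_eq (2 * x + m%:Z - 1) (2 * m%:Z).
have := modz_ge0 (2 * x + m%:Z - 1) (_ : 2 * m%:Z != 0)%R.
have := ltz_pmod (2 * x + m%:Z - 1) (_ : 0 < 2 * m%:Z)%R.
set q := (_ %/ _)%Z; set r := (_ %% _)%Z.
move=> /(_ ltac:(lia)) h1 /(_ ltac:(lia)) h2 h3.
nia.
Qed.

Lemma prime_mulz_contra (p m : nat) (t : int) :
  prime p -> 1 < m < p -> (p%:Z <> m%:Z * t)%R.
Proof.
move=> p_pr /andP[m1 mp] e.
have : m %| p by have := dvdz_mulr t (dvdzz m); rewrite -e.
by case/primeP: p_pr => _ dp /dp /orP[] /eqP; lia.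
Qed.

Lemma centered_sqr_le (m : nat) (y : int) :
  (- m%:Z < 2 * y <= m%:Z -> 4 * y ^+ 2 <= m%:Z ^+ 2)%R.
Proof. by rewrite !expr2; nia. Qed.

Lemma centered_sqr_eq (m : nat) (y : int) :
  (- m%:Z < 2 * y <= m%:Z -> 4 * y ^+ 2 = m%:Z ^+ 2 -> 2 * y = m%:Z)%R.
Proof. by rewrite !expr2; nia. Qed.

(** The two extreme values of [R] must be excluded in the descent, so the lemma
    records what each of them forces on the residues. *)
Lemma centered_sum_bounds (m : nat) (y1 y2 y3 y4 R : int) : 0 < m ->
  (- m%:Z < 2 * y1 <= m%:Z)%R -> (- m%:Z < 2 * y2 <= m%:Z)%R ->
  (- m%:Z < 2 * y3 <= m%:Z)%R -> (- m%:Z < 2 * y4 <= m%:Z)%R ->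
  (y1 ^+ 2 + y2 ^+ 2 + y3 ^+ 2 + y4 ^+ 2 = m%:Z * R)%R ->
  [/\ (0 <= R)%R, (R <= m%:Z)%R,
      R = 0%R -> [/\ y1 = 0, y2 = 0, y3 = 0 & y4 = 0]%R
    & R = m%:Z%R ->
      [/\ 2 * y1 = m%:Z, 2 * y2 = m%:Z, 2 * y3 = m%:Z & 2 * y4 = m%:Z]%R].
Proof.
move=> m0 b1 b2 b3 b4 ey.
have c1 := centered_sqr_le _ _ b1; have c2 := centered_sqr_le _ _ b2.
have c3 := centered_sqr_le _ _ b3; have c4 := centered_sqr_le _ _ b4.
have mZ0 : (0 < m%:Z)%R by [].
split.
- by rewrite -(pmulr_rge0 _ mZ0) -ey !addr_ge0 ?sqr_ge0.
- rewrite -(ler_pM2l mZ0) -expr2 -ey.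
  by clear -c1 c2 c3 c4; lia.
- move=> e0; move/eqP: ey; rewrite e0 mulr0.
  rewrite !paddr_eq0 ?addr_ge0 ?sqr_ge0 // !sqrf_eq0.
  by move=> /andP[/andP[/andP[/eqP ? /eqP ?] /eqP ?] /eqP ?].
- move=> em; move: ey; rewrite em -expr2 => ey.
  by split; apply: centered_sqr_eq => //; clear -c1 c2 c3 c4 ey; lia.
Qed.

(** Reduce the [x_i] modulo [m] to centered residues [y_i = x_i - m * z_i]; the
    sum of the [y_i ^ 2] is [m * R] with [0 <= R <= m].  If [R] were [0] or [m],
    then [m ^ 2] would divide the sum of the [x_i ^ 2], that is [m * p], so [m]
    would divide [p].  Otherwise [R] is the smaller multiplier: Euler's identity
    for the [x_i] and [y_i] has all four components divisible by [m], and the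
    quotients, written in terms of the [z_i], represent [R * p]. *)
Lemma four_squares_descent (p m : nat) :
  prime p -> 1 < m < p -> four_squares (m%:Z * p%:Z)%R ->
  exists2 r : nat, 0 < r < m & four_squares (r%:Z * p%:Z)%R.
Proof.
move=> p_pr mp [x1 [x2 [x3 [x4 ex]]]]; have /andP[m1 _] := mp.
have m_neq0 : m%:Z%R != 0%R by lia.
have [|z1 b1] := @centered_residue m x1; first by lia.
have [|z2 b2] := @centered_residue m x2; first by lia.
have [|z3 b3] := @centered_residue m x3; first by lia.
have [|z4 b4] := @centered_residue m x4; first by lia.
pose xz := (x1 * z1 + x2 * z2 + x3 * z3 + x4 * z4)%R.
pose zz := (z1 ^+ 2 + z2 ^+ 2 + z3 ^+ 2 + z4 ^+ 2)%R.
pose R := (p%:Z - 2 * xz + m%:Z * zz)%R.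
set y1 := (x1 - _)%R in b1; set y2 := (x2 - _)%R in b2.
set y3 := (x3 - _)%R in b3; set y4 := (x4 - _)%R in b4.
have ey : (y1 ^+ 2 + y2 ^+ 2 + y3 ^+ 2 + y4 ^+ 2 = m%:Z * R)%R.
  rewrite /R mulrDr mulrBr ex /y1 /y2 /y3 /y4 /xz /zz; ring.
have [R0 Rm y0 ym] := centered_sum_bounds _ _ _ _ _ _ (ltnW m1) b1 b2 b3 b4 ey.
have Rn0 : R <> 0%R.
  move=> /y0 [/subr0_eq d1 /subr0_eq d2 /subr0_eq d3 /subr0_eq d4].
  apply: (prime_mulz_contra p m zz p_pr mp).
  apply: (mulfI m_neq0).
  by rewrite ex d1 d2 d3 d4 /zz; ring.
have Rnm : R <> m.
  move=> /ym [d1 d2 d3 d4].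
  have e1 : (2 * x1 = m%:Z * (1 + 2 * z1))%R.
    by rewrite mulrDr mulr1 -{1}d1 /y1; ring.
  have e2 : (2 * x2 = m%:Z * (1 + 2 * z2))%R.
    by rewrite mulrDr mulr1 -{1}d2 /y2; ring.
  have e3 : (2 * x3 = m%:Z * (1 + 2 * z3))%R.
    by rewrite mulrDr mulr1 -{1}d3 /y3; ring.
  have e4 : (2 * x4 = m%:Z * (1 + 2 * z4))%R.
    by rewrite mulrDr mulr1 -{1}d4 /y4; ring.
  apply: (prime_mulz_contra p m (1 + zz + (z1 + z2 + z3 + z4))%R p_pr mp).
  (* The x_i are halves of odd multiples of m, so the identity is scaled by 4. *)
  apply: (@mulfI _ (4 * m%:Z)%R); first by rewrite mulf_neq0.
  transitivity ((2 * x1) ^+ 2 + (2 * x2) ^+ 2 + (2 * x3) ^+ 2 + (2 * x4) ^+ 2)%R.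
    by rewrite -mulrA ex; ring.
  by rewrite e1 e2 e3 e4 /zz; ring.
have [r er] : exists r : nat, R = r by exists `|R|%N; rewrite gez0_abs.
exists r; first by clear -R0 Rm Rn0 Rnm er; lia.
rewrite -er.
exists (p%:Z - xz)%R, (x1 * z2 - x2 * z1 + x3 * z4 - x4 * z3)%R,
  (x1 * z3 - x3 * z1 + x4 * z2 - x2 * z4)%R,
  (x1 * z4 - x4 * z1 + x2 * z3 - x3 * z2)%R.
transitivity (p%:Z ^+ 2 - 2 * p%:Z * xz + (m%:Z * p%:Z) * zz)%R.
  by rewrite /R; ring.
by rewrite ex /xz /zz; ring.
Qed.

Lemma prime_four_squares p : prime p -> four_squares p.
Proof.
move=> p_pr; have [->|p_odd] := even_prime p_pr.
  by exists 1%R, 1%R, 0%R, 0%R.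
have [a [b [ha hb /dvdnP[m em]]]] := prime_dvd_two_squares_succ _ p_pr p_odd.
have p1 := prime_gt1 p_pr; rewrite -!mulnn in em.
have mp : 0 < m < p.
  have a4 := ltn_mul ha ha; have b4 := ltn_mul hb hb.
  rewrite lt0n; apply/andP; split; first by apply/eqP => m0; lia.
  by rewrite -(@ltn_pmul2r p) -?em; lia.
have : four_squares (m%:Z * p%:Z)%R.
  exists a%:Z%R, b%:Z%R, 1%R, 0%R; rewrite -PoszM -em !expr2; lia.
have [k] := ubnP m; elim: k => // k IH in m mp {em} *.
rewrite ltnS => mk; have [->|m1] := eqVneq m 1; first by rewrite mul1r.
case/four_squares_descent => //; first by lia.
by move=> r hr; apply: IH; lia.
Qed.

Theorem lagrange_four_squares (n : nat) :
  exists a b c d : nat, n = a ^ 2 + b ^ 2 + c ^ 2 + d ^ 2.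
Proof.
have : four_squares n.
  have [k] := ubnP n; elim: k => // k IH in n *; rewrite ltnS => nk.
  have [n1|n1] := leqP n 1.
    by exists n%:Z%R, 0%R, 0%R, 0%R; rewrite !expr2; nia.
  have [q qE] := dvdnP (pdiv_dvd n); have p_pr := pdiv_prime n1.
  rewrite qE PoszM; apply: four_squaresM; last exact: prime_four_squares.
  by apply: IH; have := prime_gt1 p_pr; nia.
case=> a [b [c [d e]]]; exists `|a|%N, `|b|%N, `|c|%N, `|d|%N.
by rewrite -!mulnn; rewrite !expr2 in e; nia.
Qed.

(** * Two almost equal squares and a multiple of a small parameter *)

Lemma floor_step (f : nat -> nat) (m : nat) :
  f 0 <= m -> (forall q, q <= f q) -> exists q, f q <= m < f q.+1.
Proof.
move=> f0 fge; have ex : exists q, m < f q.+1 by exists m; apply: fge.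
case: (ex_minnP ex) => q mq qmin; exists q; rewrite mq andbT.
case: q qmin {mq} => [//|q] qmin; rewrite leqNgt; apply/negP => /qmin.
by rewrite ltnn.
Qed.

(** Take [q * (q + 1)] just below [2 * m].  With [i = 0] the value of [h] is half
    the remainder, which is at most [q + 1]; only the last few remainders give
    [h >= q], and for these [i = 3] lowers [h] by 6 while the bound on [h] drops
    only by 3. *)
Lemma window_pronic m : 100 <= m ->
  exists q i h, [/\ 0 < h, h + i < q & m.*2 = q * q.+1 + i * i.+1 + h.*2].
Proof.
move=> mge.
have [||q /andP[/= lo hi]] := @floor_step (fun q => q * q.+1) (m.*2 - 2) => //.
  by move=> q; nia.
have q10 : 10 <= q by nia.
have qev : exists r, q * q.+1 = r.*2.
  by exists (q * q.+1)./2; rewrite -[LHS]odd_double_half oddM /= andbN.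
case: qev => r er.
have [small|large] := leqP (m - r).+1 q.
  by exists q, 0, (m - r); split; lia.
by exists q, 3, (m - r - 6); split; nia.
Qed.

(** As for [window_pronic], except that [i] must have the parity of the
    remainder [r]: small remainders use [i = 0] or [1], the last ones [4] or [5].
    Keeping [r >= 3] ensures [h > 0] in the first case. *)
Lemma window_square2 m : 400 <= m ->
  exists q i h, [/\ 0 < h, h + i < q & m = q * q + i * i + h.*2].
Proof.
move=> mge.
have [||q /andP[/= lo hi]] := @floor_step (fun q => q * q) (m - 3) => //.
  by move=> q; nia.
have q14 : 14 <= q by nia.
have [r er] : exists r, m = q * q + r by exists (m - q * q); lia.
have rhi : r <= q.*2 + 3 by nia.
have r3 : 3 <= r by lia.
have eb := odd_double_half r.
have [small|large] := leqP (r + 3) q.*2.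
  by exists q, (odd r), r./2; case: (odd r) eb => /= eb; split; lia.
(* 8 + 4 * odd r is the integer part of (4 + odd r) ^ 2 / 2. *)
exists q, (4 + odd r), (r./2 - (8 + 4 * odd r)).
case: (odd r) eb => /= eb; split; lia.
Qed.

(** Modulo 4, [q] and [i] have to be both even when [m] is divisible by 4 and
    both odd otherwise.  Substituting [2 * q], [2 * j] or [2 * q + 1], [2 * j + 1]
    leaves, with [M] the integer part of [m / 4], the equation
    [M = q ^ 2 + j ^ 2 + h], respectively [M = q * (q + 1) + j * (j + 1) + h];
    it is solved with [j = 0] or [j = 3]. *)
Lemma window_square4 m : 400 <= m -> ~~ odd m ->
  exists q i h, [/\ 0 < h, h + i < q & m = q * q + i * i + 4 * h].
Proof.
move=> mge modd; have em := odd_double_half m; rewrite (negbTE modd) /= in em.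
have eh := odd_double_half m./2; set M := (m./2)./2 in eh.
have [o|o] := boolP (odd m./2); rewrite ?o ?(negbTE o) /= in eh.
  have [||q /andP[/= lo hi]] := @floor_step (fun q => q * q.+1) (M - 1) => //.
    by move=> q; nia.
  have q7 : 7 <= q by nia.
  have [r er] : exists r, M = q * q.+1 + r by exists (M - q * q.+1); lia.
  have [small|large] := ltnP r q.*2.
    by exists q.*2.+1, 1, r; split; nia.
  by exists q.*2.+1, 7, (r - 12); split; nia.
have [||q /andP[/= lo hi]] := @floor_step (fun q => q * q) (M - 1) => //.
  by move=> q; nia.
have q7 : 7 <= q by nia.
have [r er] : exists r, M = q * q + r by exists (M - q * q); lia.
have [small|large] := ltnP r q.*2.
  by exists q.*2, 0, r; split; nia.
by exists q.*2, 6, (r - 9); split; nia.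
Qed.

(** * The parametrization of the cone *)

Definition sumsq (s : seq nat) : nat := sumn [seq x ^ 2 | x <- s].

Definition representable (k n : nat) : Prop :=
  exists s : seq nat,
    [/\ size s = k, all (leq 1) s, sumn s = n & exists m, sumsq s = m ^ 2].

Lemma representable_cone (s : seq nat) (h c : nat) :
  0 < h -> 0 < c -> all (leq 1) s -> sumsq s = h ^ 2 + c.*2 ->
  representable (size s).+1 (h * sumn s + c).
Proof.
move=> h0 c0 s0 es; exists (c :: [seq h * x | x <- s]).
have sumZ : sumn [seq h * x | x <- s] = h * sumn s.
  by elim: s {s0 es} => [|x s IH] /=; rewrite ?muln0 // IH mulnDr.
have sqZ : sumsq [seq h * x | x <- s] = h ^ 2 * sumsq s.
  rewrite /sumsq; elim: s {s0 es sumZ} => [|x s IH] /=; rewrite ?muln0 //.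
  by rewrite IH mulnDr expnMn.
split=> /=.
- by rewrite size_map.
- rewrite c0 all_map; apply: sub_all s0 => x /= x0.
  by rewrite muln_gt0 h0.
- by rewrite sumZ addnC.
- exists (h ^ 2 + c); rewrite -[LHS]/(c ^ 2 + sumsq _) sqZ es -!mulnn; lia.
Qed.

(** * Four and five summands *)

(** The list is [[:: t_1 - h; t_2 - h; h + u]] with [t_1 = q - i], and
    [t_2 = q + i + 1], [u = 1] when [n] is odd, [t_2 = q + i], [u = 2] when [n] is
    even.  For even [n] the simpler choice [u = 1] is impossible, since then
    [t_1 ^ 2 + t_2 ^ 2 = 2 * n - 1 - 4 * h] would be congruent to 3 modulo 4. *)
Lemma representable4 n : 1200 < n -> representable 4 n.
Proof.
move=> nge; have en := odd_double_half n.
have [o|o] := boolP (odd n); rewrite ?o ?(negbTE o) /= in en.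
  have [|q [i [h [h0 hq e]]]] := @window_pronic n./2; first by lia.
  have [a ea] : exists a, q = a + i + h by exists (q - i - h); lia.
  have -> : n = h * sumn [:: a; a + i.*2.+1; h.+1]
      + ((a + i) * (a + i).+1 + i * i.+1 + h.+1) by rewrite /=; nia.
  by apply: (representable_cone [:: _; _; _]) => //=;
  [lia | lia | rewrite /sumsq /= -!mulnn; lia].
have [||q [i [h [h0 hq e]]]] := @window_square4 (n - 2); [by lia | by lia|].
have [a ea] : exists a, q = a + i + h by exists (q - i - h); lia.
have -> : n = h * sumn [:: a; a + i.*2; h.+2]
    + ((a + i) * (a + i) + i * i + (h.+1).*2) by rewrite /=; nia.
by apply: (representable_cone [:: _; _; _]) => //=;
  [lia | lia | rewrite /sumsq /= -!mulnn; lia].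
Qed.

(** The list is [[:: t_1 - h; t_2 - h; h; 2]] with [t_1 = q - i] and
    [t_2 = q + i]; the equation [2 * n - 4 = t_1 ^ 2 + t_2 ^ 2 + 4 * h] is then
    [n - 2 = q ^ 2 + i ^ 2 + 2 * h]. *)
Lemma representable5 n : 1200 < n -> representable 5 n.
Proof.
move=> nge.
have [|q [i [h [h0 hq e]]]] := @window_square2 (n - 2); first by lia.
have [a ea] : exists a, q = a + i + h by exists (q - i - h); lia.
have -> : n = h * sumn [:: a; a + i.*2; h; 2]
    + ((a + i) * (a + i) + i * i + 2) by rewrite /=; nia.
by apply: (representable_cone [:: _; _; _; _]) => //=;
  [lia | lia | rewrite /sumsq /= -!mulnn; lia].
Qed.

(** * Six or more summands *)

Lemma sumsq_cat s t : sumsq (s ++ t) = sumsq s + sumsq t.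
Proof. by rewrite /sumsq map_cat sumn_cat. Qed.

(** For a four-square representation with [c0] zeros and [c1] ones, the list [t]
    takes the place of these entries and of the square [13 ^ 2]: the ones are
    absorbed into the sum, and the length makes up for all removed entries.  The
    number 169 serves because each [169 + c1] with [c1 <= 4] is a sum of [j]
    squares of integers at least 2 for every [j] from [c1 + 1] to 5. *)
Lemma pad169 (c0 c1 : nat) : c0 + c1 <= 4 ->
  exists t, [/\ size t = (c0 + c1).+1, all (leq 2) t & sumsq t = 169 + c1].
Proof.
case: c0 => [|[|[|[|[|c0]]]]]; case: c1 => [|[|[|[|[|c1]]]]] //= _.
- by exists [:: 13].
- by exists [:: 7; 11].
- by exists [:: 3; 9; 9].
- by exists [:: 2; 2; 8; 10].
- by exists [:: 2; 2; 4; 7; 10].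
- by exists [:: 5; 12].
- by exists [:: 5; 8; 9].
- by exists [:: 3; 3; 3; 12].
- by exists [:: 2; 2; 2; 4; 12].
- by exists [:: 3; 4; 12].
- by exists [:: 2; 2; 9; 9].
- by exists [:: 2; 3; 3; 7; 10].
- by exists [:: 2; 4; 7; 10].
- by exists [:: 2; 2; 3; 3; 12].
- by exists [:: 2; 2; 2; 6; 11].
Qed.

Lemma five_squares_ge2 n : 169 <= n ->
  exists s, [/\ size s = 5, all (leq 2) s & sumsq s = n].
Proof.
move=> nge; have [a [b [c [d e]]]] := lagrange_four_squares (n - 169).
pose s := [:: a; b; c; d]; pose big := [seq x <- s | 2 <= x].
have size_s u :
    size [seq x <- u | 2 <= x] + (count_mem 0 u + count_mem 1 u) = size u.
  by elim: u => [|[|[|x]] u IH] //=; rewrite -IH; ring.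
have sum_s u : sumsq [seq x <- u | 2 <= x] + count_mem 1 u = sumsq u.
  by rewrite /sumsq; elim: u => [|[|[|x]] u IH] //=; rewrite -IH; ring.
have [|t [size_t ge_t sum_t]] := pad169 (count_mem 0 s) (count_mem 1 s).
  by have := size_s s; rewrite [size s]/=; lia.
exists (t ++ big); split.
- by rewrite size_cat size_t; have := size_s s; rewrite -/big [size s]/=; lia.
- by rewrite all_cat ge_t filter_all.
- rewrite sumsq_cat sum_t; have := sum_s s; rewrite -/big.
  have -> : sumsq s = n - 169 by rewrite /sumsq /= e !addnA addn0.
  lia.
Qed.

Lemma sumsq_pred s : all (leq 2) s ->
  sumsq s = sumsq (map predn s) + (sumn (map predn s)).*2 + size s.
Proof.
rewrite /sumsq; elim: s => [|x s IH] //= /andP[x2 /IH ->].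
by rewrite -!mulnn; nia.
Qed.

Lemma leq_sumn_sumsq s : sumn s <= sumsq s.
Proof. by rewrite /sumsq; elim: s => [|x s IH] //=; rewrite -mulnn; nia. Qed.

(** This is the case [h = 1]: the list for the cone is obtained by lowering by
    one each entry of a list of [k - 1] integers at least 2 whose sum of squares
    is [2 * n + k]. *)
Lemma representable_ge6 k n : 6 <= k -> 2 * k + 100 <= n -> representable k n.
Proof.
move=> k6 kn.
(* 2 * n + k minus the k - 6 squares equal to 4. *)
have [|y [size_y ge_y sum_y]] := five_squares_ge2 (2 * n + 24 - 3 * k).
  by lia.
pose s := y ++ nseq (k - 6) 2.
have ge_s : all (leq 2) s by rewrite all_cat ge_y all_nseq orbT.
have size_s : size s = k.-1 by rewrite size_cat size_y size_nseq; lia.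
have sum_s : sumsq s = 2 * n + k.
  by rewrite sumsq_cat sum_y /sumsq map_nseq sumn_nseq; lia.
pose x := map predn s; have := sumsq_pred s ge_s; rewrite sum_s size_s -/x => ex.
have ge_x : all (leq 1) x by rewrite all_map; apply: sub_all ge_s => -[|[]].
have size_x : size x = k.-1 by rewrite size_map.
have le1 := leq_sumn_sumsq x.
(* 3 * sumn x <= sumsq x + 2 * sumn x = 2 * n + 1, so the last summand is
   positive. *)
have -> : n = 1 * sumn x + (n - sumn x) by lia.
have -> : k = (size x).+1 by rewrite size_x; lia.
by apply: representable_cone => //; lia.
Qed.

Theorem theorem1p5 (k : nat) (hk : 4 <= k) (n : nat)
    (hn : maxn (20 * k) 1200 < n) :
  exists x : 'I_k -> nat,
    [/\ forall i, 0 < x i,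
        n = \sum_(i < k) x i
      & perfect_square (\sum_(i < k) x i ^ 2)].
Proof.
have [s [size_s pos_s sum_s [m sq_s]]] : representable k n.
  have [->|k4] := eqVneq k 4; first by apply: representable4; lia.
  have [->|k5] := eqVneq k 5; first by apply: representable5; lia.
  by apply: representable_ge6; lia.
exists (fun i => nth 0 s i); split.
- by move=> i; apply: (allP pos_s); rewrite mem_nth ?size_s.
- by rewrite -sum_s sumnE (big_nth 0) big_mkord size_s.
- exists m; rewrite expr2 -PoszM mulnn -sq_s; congr Posz.
  by rewrite /sumsq sumnE big_map (big_nth 0) big_mkord size_s.
Qed.
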